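(* Let $W_\Gamma$ be the Coxeter group associated to a Coxeter graph $\Gamma$. Suppose there exists a full subgraph $\Omega\subseteq\Gamma$ such that the special subgroup $W_\Omega$ is infinite, the outer automorphism group $\mathrm{Out}(W_\Omega)$ is finite, and for every edge $\{v,w\}\in E(\Gamma)$ with $v\in V(\Gamma)-V(\Omega)$ and $w\in V(\Omega)$ the edge label of $\{v,w\}$ is even. Then the automorphism group $\mathrm{Aut}(W_\Gamma)$ virtually surjects onto an infinite special subgroup of $W_\Omega$; that is, there exist a finite index subgroup $H\subseteq\mathrm{Aut}(W_\Gamma)$, a full subgraph $\Lambda\subseteq\Omega$ such that $W_\Lambda$ is infinite, and a surjective group homomorphism $H\twoheadrightarrow W_\Lambda$.
   Context: A Coxeter graph is a finite simplicial graph $\Gamma$ with vertex set $V(\Gamma)$, edge set $E(\Gamma)$ (a set of two-element subsets of $V(\Gamma)$) and an edge-labeling $\varphi\colon E(\Gamma)\to\{2,3,4,\ldots\}$. The associated Coxeter group is $$W_\Gamma=\langle V(\Gamma)\mid v^2 \text{ for all } v\in V(\Gamma),\ (vw)^{\varphi(\{v,w\})}\text{ for all }\{v,w\}\in E(\Gamma)\rangle$$ (there is no relation between $v$ and $w$ when they are not adjacent). A full subgraph $\Lambda\subseteq\Gamma$ is one that contains every edge of $\Gamma$ between its vertices. For such $\Lambda$ the subgroup of $W_\Gamma$ generated by $V(\Lambda)$ is canonically isomorphic to the Coxeter group $W_\Lambda$ (with the restricted labeling), is denoted $W_\Lambda$, and is called a special (parabolic) subgroup. *)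

(* Defs.v *)
From HB Require Import structures.
From mathcomp Require Import all_boot.
From mathcomp Require Import boolp classical_sets functions cardinality.

Set Implicit Arguments.
Unset Strict Implicit.
Unset Printing Implicit Defensive.

Local Open Scope quotient_scope.
Local Open Scope group_scope.

(* A subgroup of [G] is an [S : groupClosed G]; [subgroup S] is the same
   subgroup regarded as a group in its own right. *)
Section Subgroup.
Variables (G : groupType) (S : groupClosed G).

Definition subgroup : Type := {x : G | x \in S}.

HB.instance Definition _ := SubChoice.on subgroup.

Fact subgroup_closed : group_closed [pred x : G | x \in S].
Proof. by split=> [|x y xS yS]; [exact: gpred1 | exact: gpredF]. Qed.

HB.instance Definition _ :=
  SubChoice_isSubGroup.Build G [pred x : G | x \in S] subgroup subgroup_closed.

Definition left_coset (x : G) : set G := [set y | exists2 h, h \in S & y = x * h]%classic.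

Definition finite_index : Prop := finite_set (range left_coset).

End Subgroup.

Section Generated.
Variables (G : groupType) (A : set G).

Definition generated : {pred G} :=
  fun x => `[< forall S : groupClosed G, (forall a, A a -> a \in S) -> x \in S >].

Fact generated1 : 1 \in generated.
Proof. by apply/asboolP => S _; exact: gpred1. Qed.

Fact generatedM : mulg_closed generated.
Proof.
by move=> x y /asboolP xA /asboolP yA; apply/asboolP => S AS;
  apply: gpredM; [exact: xA | exact: yA].
Qed.

Fact generatedV : invg_closed generated.
Proof.
by move=> x /asboolP xA; apply/asboolP => S AS; apply: gpredVr; exact: xA.
Qed.

HB.instance Definition _ := isMulClosed.Build G generated generatedM.
HB.instance Definition _ := isMul1Closed.Build G generated generated1.
HB.instance Definition _ := isInvClosed.Build G generated generatedV.

End Generated.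

Record Aut (G : groupType) : Type := Automorphism {
  aut_fun :> G -> G;
  aut_morph : {morph aut_fun : x y / x * y};
  aut_bij : bijective aut_fun }.

HB.instance Definition _ G := gen_eqMixin (Aut G).
HB.instance Definition _ G := gen_choiceMixin (Aut G).

Fact aut_monoid_morphism (G : groupType) (f : Aut G) : monoid_morphism f.
Proof.
split; last exact: aut_morph.
by apply: (mulgI (f 1)); rewrite -aut_morph !mulg1.
Qed.

HB.instance Definition _ (G : groupType) (f : Aut G) :=
  isUMagmaMorphism.Build G G (aut_fun f) (aut_monoid_morphism f).

Section AutGroup.
Variable G : groupType.
Implicit Types f g h : Aut G.

Lemma aut_ext f g : f =1 g -> f = g.
Proof.
case: f g => [f fM fB] [g gM gB] /= /funext fg; case: _ / fg in gM gB *.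
by congr Automorphism; exact: Prop_irrelevance.
Qed.

Definition aut_one : Aut G :=
  @Automorphism G idfun (fun _ _ => erefl) (Bijective (frefl _) (frefl _)).

Fact aut_mul_morph f g : {morph f \o g : x y / x * y}.
Proof. by move=> x y /=; rewrite !aut_morph. Qed.

Definition aut_mul f g : Aut G :=
  Automorphism (@aut_mul_morph f g) (bij_comp (aut_bij f) (aut_bij g)).

Fact aut_inv_subproof f : {g : Aut G | cancel f g /\ cancel g f}.
Proof.
apply: cid; case: (aut_bij f) => g fK gK.
have gM : {morph g : x y / x * y}.
  by move=> x y; apply: (bij_inj (aut_bij f)); rewrite aut_morph !gK.
by exists (Automorphism gM (Bijective gK fK)).
Qed.

Definition aut_inv f : Aut G := sval (aut_inv_subproof f).

Lemma aut_invK f : cancel f (aut_inv f).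
Proof. by rewrite /aut_inv; case: aut_inv_subproof => g []. Qed.

Lemma aut_Kinv f : cancel (aut_inv f) f.
Proof. by rewrite /aut_inv; case: aut_inv_subproof => g []. Qed.

Fact aut_mulA : associative aut_mul. Proof. by move=> f g h; exact: aut_ext. Qed.
Fact aut_mul1g : left_id aut_one aut_mul. Proof. by move=> f; exact: aut_ext. Qed.
Fact aut_mulg1 : right_id aut_one aut_mul. Proof. by move=> f; exact: aut_ext. Qed.
Fact aut_mulVg : left_inverse aut_one aut_inv aut_mul.
Proof. by move=> f; apply: aut_ext => x; exact: aut_invK. Qed.
Fact aut_mulgV : right_inverse aut_one aut_inv aut_mul.
Proof. by move=> f; apply: aut_ext => x; exact: aut_Kinv. Qed.

HB.instance Definition _ :=
  isGroup.Build (Aut G) aut_mulA aut_mul1g aut_mulg1 aut_mulVg aut_mulgV.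

Lemma autME f g x : (f * g) x = f (g x). Proof. by []. Qed.
Lemma aut1E x : (1 : Aut G) x = x. Proof. by []. Qed.

Lemma autV f x : f x^-1 = (f x)^-1. Proof. exact: (gmulfV f). Qed.

Definition Inn : {pred Aut G} := fun f => `[< exists a, forall x, f x = a * x / a >].

Fact Inn1 : 1 \in Inn.
Proof. by apply/asboolP; exists 1 => x; rewrite invg1 mulg1 mul1g. Qed.

Fact InnM : mulg_closed Inn.
Proof.
move=> f g /asboolP[a fa] /asboolP[b gb]; apply/asboolP; exists (a * b) => x.
by rewrite autME gb fa invgM !mulgA.
Qed.

Fact InnV : invg_closed Inn.
Proof.
move=> f /asboolP[a fa]; apply/asboolP; exists a^-1 => x.
apply: (bij_inj (aut_bij f)); rewrite -autME mulgV fa invgK.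
by rewrite !mulgA mulgV mul1g mulgK.
Qed.

HB.instance Definition _ := isMulClosed.Build (Aut G) Inn InnM.
HB.instance Definition _ := isMul1Closed.Build (Aut G) Inn Inn1.
HB.instance Definition _ := isInvClosed.Build (Aut G) Inn InnV.

Lemma Inn_normal f g : f \in Inn -> g^-1 * f * g \in Inn.
Proof.
move=> /asboolP[a fa]; apply/asboolP; exists (g^-1 a) => x.
have gK y : g (g^-1 y) = y by rewrite -autME mulgV.
by rewrite !autME fa; apply: (bij_inj (aut_bij g)); rewrite !aut_morph autV !gK.
Qed.

Definition out_rel f g := f^-1 * g \in Inn.

Fact out_refl : reflexive out_rel.
Proof. by move=> f; rewrite /out_rel mulVg gpred1. Qed.

Fact out_sym : symmetric out_rel.
Proof. by move=> f g; rewrite /out_rel -[RHS]gpredV invgM invgK. Qed.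

Fact out_trans : transitive out_rel.
Proof.
move=> g f h fg gh; rewrite /out_rel.
by rewrite -[X in f^-1 * X](mulKg g^-1) invgK mulgA gpredM.
Qed.

Canonical out_equiv := EquivRel out_rel out_refl out_sym out_trans.

Definition Out : Type := {eq_quot out_equiv}.

HB.instance Definition _ := Choice.on Out.
HB.instance Definition _ := EqQuotient.on Out.

Definition out_one : Out := \pi_Out 1.
Definition out_mul (x y : Out) : Out := \pi_Out (repr x * repr y).
Definition out_inv (x : Out) : Out := \pi_Out (repr x)^-1.

Lemma out_eqP f g : reflect (\pi_Out f = \pi_Out g) (f^-1 * g \in Inn).
Proof. exact: (iffP (@eqquotP _ _ Out f g)). Qed.

Lemma out_mulE f g : out_mul (\pi f) (\pi g) = \pi_Out (f * g).
Proof.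
have /out_eqP f_f : \pi_Out (repr (\pi_Out f)) = \pi_Out f by rewrite reprK.
have /out_eqP g_g : \pi_Out (repr (\pi_Out g)) = \pi_Out g by rewrite reprK.
apply/out_eqP; set f' := repr (\pi_Out f) in f_f *.
set g' := repr (\pi_Out g) in g_g *.
have -> : (f' * g')^-1 * (f * g) = (g'^-1 * (f'^-1 * f) * g') * (g'^-1 * g).
  by rewrite invgM !mulgA mulgK.
by rewrite gpredM // Inn_normal.
Qed.

Lemma out_invE f : out_inv (\pi f) = \pi_Out f^-1.
Proof.
have /out_eqP f_f : \pi_Out f = \pi_Out (repr (\pi_Out f)) by rewrite reprK.
apply/out_eqP; set f' := repr (\pi_Out f) in f_f *.
have -> : f'^-1^-1 * f^-1 = f'^-1^-1 * (f'^-1 * f)^-1^-1^-1 * f'^-1.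
  by rewrite !invgK invgM invgK !mulgA mulgK.
rewrite Inn_normal // invgK -gpredV invgK -gpredV invgM invgK.
exact: f_f.
Qed.

Fact out_mulA : associative out_mul.
Proof.
by move=> x y z; rewrite -(reprK x) -(reprK y) -(reprK z) !out_mulE mulgA.
Qed.
Fact out_mul1g : left_id out_one out_mul.
Proof. by move=> x; rewrite -(reprK x) out_mulE mul1g. Qed.
Fact out_mulg1 : right_id out_one out_mul.
Proof. by move=> x; rewrite -(reprK x) out_mulE mulg1. Qed.
Fact out_mulVg : left_inverse out_one out_inv out_mul.
Proof. by move=> x; rewrite -(reprK x) out_invE out_mulE mulVg. Qed.
Fact out_mulgV : right_inverse out_one out_inv out_mul.
Proof. by move=> x; rewrite -(reprK x) out_invE out_mulE mulgV. Qed.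

HB.instance Definition _ :=
  isGroup.Build Out out_mulA out_mul1g out_mulg1 out_mulVg out_mulgV.

End AutGroup.

Arguments Inn G : clear implicits.

(* In a word, the letter [(x, true)] stands for the generator [x] and
   [(x, false)] for its inverse. *)
Definition word (X : choiceType) : Type := seq (X * bool).

HB.instance Definition _ (X : choiceType) := Choice.on (word X).

(* Equality in < X | R >: the least congruence on words containing free
   cancellation and killing the relators. *)
Inductive pres_eq (X : choiceType) (R : set (word X)) : word X -> word X -> Prop :=
| PresRefl u : pres_eq R u u
| PresSym u v : pres_eq R u v -> pres_eq R v u
| PresTrans v u w : pres_eq R u v -> pres_eq R v w -> pres_eq R u w
| PresCat u u' v v' :
    pres_eq R u u' -> pres_eq R v v' -> pres_eq R (u ++ v) (u' ++ v')
| PresCancel x b : pres_eq R [:: (x, b); (x, ~~ b)] [::]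
| PresRelator r : R r -> pres_eq R r [::].

Section Presentation.
Variables (X : choiceType) (R : set (word X)).
Implicit Types u v w : word X.

Definition pres_rel u v : bool := `[< pres_eq R u v >].

Fact pres_rel_refl : reflexive pres_rel.
Proof. by move=> u; apply/asboolP; exact: PresRefl. Qed.

Fact pres_rel_sym : symmetric pres_rel.
Proof. by move=> u v; apply/asboolP/asboolP; exact: PresSym. Qed.

Fact pres_rel_trans : transitive pres_rel.
Proof.
by move=> v u w /asboolP uv /asboolP vw; apply/asboolP; exact: PresTrans vw.
Qed.

Canonical pres_equiv :=
  EquivRel pres_rel pres_rel_refl pres_rel_sym pres_rel_trans.

Definition presented : Type := {eq_quot pres_equiv}.

HB.instance Definition _ := Choice.on presented.
HB.instance Definition _ := EqQuotient.on presented.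

Definition word_inv u : word X := rev [seq (a.1, ~~ a.2) | a <- u].

Definition pres_one : presented := \pi_presented [::].
Definition pres_mul (x y : presented) : presented :=
  \pi_presented (repr x ++ repr y).
Definition pres_inv (x : presented) : presented :=
  \pi_presented (word_inv (repr x)).

Lemma pres_eqP u v :
  (\pi_presented u = \pi_presented v) <-> pres_eq R u v.
Proof.
split=> [/(@eqquotP _ _ presented) /asboolP // | uv].
by apply/(@eqquotP _ _ presented)/asboolP.
Qed.

Lemma pres_repr u : pres_eq R (repr (\pi_presented u)) u.
Proof. by apply/pres_eqP; rewrite reprK. Qed.

Lemma pres_mulE u v : pres_mul (\pi u) (\pi v) = \pi_presented (u ++ v).
Proof. by apply/pres_eqP/PresCat; exact: pres_repr. Qed.

Fact pres_mulA : associative pres_mul.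
Proof.
by move=> x y z; rewrite -(reprK x) -(reprK y) -(reprK z) !pres_mulE catA.
Qed.
Fact pres_mul1g : left_id pres_one pres_mul.
Proof. by move=> x; rewrite -(reprK x) pres_mulE. Qed.
Fact pres_mulg1 : right_id pres_one pres_mul.
Proof. by move=> x; rewrite -(reprK x) pres_mulE cats0. Qed.

Lemma word_mulV u : pres_eq R (u ++ word_inv u) [::].
Proof.
elim: u => [|[x b] u IHu]; first exact: PresRefl.
have -> : ((x, b) :: u) ++ word_inv ((x, b) :: u)
    = [:: (x, b)] ++ (u ++ word_inv u) ++ [:: (x, ~~ b)].
  by rewrite /word_inv /= rev_cons -cats1 catA.
apply: (PresTrans _ (PresCancel R x b)).
apply: (@PresCat _ _ [:: (x, b)] [:: (x, b)] _ [:: (x, ~~ b)]).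
  exact: PresRefl.
by apply: (@PresCat _ _ _ [::] _ [:: (x, ~~ b)]) => //; exact: PresRefl.
Qed.

Lemma word_invK : involutive word_inv.
Proof.
move=> u; rewrite /word_inv map_rev revK -map_comp -[RHS]map_id.
by apply: eq_map => -[x b] /=; rewrite negbK.
Qed.

Fact pres_mulgV : right_inverse pres_one pres_inv pres_mul.
Proof.
move=> x; rewrite -{1}(reprK x) /pres_inv pres_mulE.
by apply/pres_eqP; exact: word_mulV.
Qed.
Fact pres_mulVg : left_inverse pres_one pres_inv pres_mul.
Proof.
move=> x; rewrite -{2}(reprK x) /pres_inv pres_mulE.
apply/pres_eqP; rewrite -{2}(word_invK (repr x)); exact: word_mulV.
Qed.

HB.instance Definition _ := isGroup.Build presented
  pres_mulA pres_mul1g pres_mulg1 pres_mulVg pres_mulgV.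

Definition pres_gen (x : X) : presented := \pi_presented [:: (x, true)].

End Presentation.

(* Only the values of [label] on [edges] are meaningful. *)
Record coxeterGraph : Type := CoxeterGraph {
  vertex :> finType;
  edges : {set {set vertex}};
  label : {set vertex} -> nat;
  edge_card : forall e, e \in edges -> #|e| = 2;
  label_ge2 : forall e, e \in edges -> 2 <= label e }.

Section Coxeter.
Variable Gamma : coxeterGraph.

Definition edge (v w : Gamma) : bool := [set v; w]%SET \in edges Gamma.
Definition edge_label (v w : Gamma) : nat := label [set v; w]%SET.

Inductive coxeter_relator : word Gamma -> Prop :=
| VertexRelator v : coxeter_relator [:: (v, true); (v, true)]
| EdgeRelator v w : edge v w ->
    coxeter_relator
      (flatten (nseq (edge_label v w) [:: (v, true); (w, true)])).

Definition coxeterGroup : groupType := presented coxeter_relator.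

Definition coxeter_gen (v : Gamma) : coxeterGroup := pres_gen coxeter_relator v.

(* A full subgraph is determined by its vertex set [A]; the special subgroup
   W_A is the subgroup of W_Gamma generated by [A].  When [B] is a subset of
   [A], the special subgroup of W_A attached to [B] is also the one of W_Gamma. *)
Definition special (A : {set Gamma}) : groupClosed coxeterGroup :=
  generated [set coxeter_gen v | v in [set` A]]%classic.

End Coxeter.

Definition infinite_group (G : groupType) : Prop := infinite_set [set: G]%classic.
Definition finite_group (G : groupType) : Prop := finite_set [set: G]%classic.

(* Main.v *)
(* By the exchange condition, an involution of minimal length in its conjugacy
   class is the longest element of the special subgroup generated by its
   descents, so W_Gamma has finitely many conjugacy classes of involutions and a
   finite index subgroup of Aut(W_Gamma) preserves the class of every vertex
   outside Omega.  Since the boundary labels are even, killing these vertices is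
   a retraction of W_Gamma onto W_Omega, and that subgroup acts on W_Omega
   through it.  As Out(W_Omega) is finite, a smaller finite index subgroup H acts
   by inner automorphisms, i.e. maps onto W_Omega modulo its centre.  Finally,
   a minimal infinite direct factor W_Lambda of W_Omega has trivial centre: the
   descents of a nontrivial central element would split off a finite direct
   factor.  Hence the projection of W_Omega onto W_Lambda kills the centre of
   W_Omega, and H maps onto W_Lambda. *)
Require Import Defs.
From HB Require Import structures.
From mathcomp Require Import all_boot.
From mathcomp Require Import boolp classical_sets functions cardinality.

Set Implicit Arguments.
Unset Strict Implicit.
Unset Printing Implicit Defensive.

Local Open Scope quotient_scope.
Local Open Scope group_scope.

(** * Evaluation of words and the universal property of a presentation *)

Section PresentedGroup.
Variables (X : choiceType) (R : set (word X)).

Definition word_eval (G : groupType) (h : X -> G) (u : word X) : G :=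
  \prod_(a <- u) (if a.2 then h a.1 else (h a.1)^-1).

Lemma pres_wordE u : \pi_(presented R) u = word_eval (pres_gen R) u.
Proof.
rewrite /word_eval; elim: u => [|[x b] u IHu]; first by rewrite big_nil.
rewrite big_cons -IHu -[_ :: u]cat1s -pres_mulE; congr (_ * _).
case: b => //=; apply: esym; apply: mulg1_eq.
by rewrite /pres_gen [LHS]pres_mulE; apply/pres_eqP; exact: PresCancel.
Qed.

Lemma pres_lift (G : groupType) (h : X -> G) :
    (forall r, R r -> word_eval h r = 1) ->
  exists2 phi : presented R -> G,
    {morph phi : x y / x * y} & forall x, phi (pres_gen R x) = h x.
Proof.
move=> hR.
have evalD u v : word_eval h (u ++ v) = word_eval h u * word_eval h v.
  by rewrite /word_eval big_cat.
have eval_eq u v : pres_eq R u v -> word_eval h u = word_eval h v.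
  elim=> {u v} [//|u v _ ->|v u w _ -> _ -> //|u u' v v' _ IHu _ IHv|x b|r Rr].
  - by [].
  - by rewrite !evalD IHu IHv.
  - rewrite /word_eval !big_cons big_nil mulg1.
    by case: b => /=; rewrite ?mulgV ?mulVg.
  - by rewrite hR // /word_eval big_nil.
exists (fun x => word_eval h (repr x)) => [x y|x].
  rewrite -evalD; apply: eval_eq; rewrite -[x * y]/(pres_mul x y).
  exact: pres_repr.
rewrite (eval_eq _ _ (pres_repr R _)).
by rewrite /word_eval big_cons big_nil mulg1.
Qed.

End PresentedGroup.

(** * Reflections of a word, word length and the exchange condition *)

Section CoxeterLength.
Variable Gamma : coxeterGraph.
Notation W := (coxeterGroup Gamma).
Notation g := (@coxeter_gen Gamma).
Notation P s := (\prod_(v <- s) g v).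
Implicit Types (u v : Gamma) (s : seq Gamma) (A I : {set Gamma}) (x y w : W).

Lemma coxeter_genM v : g v * g v = 1.
Proof.
by rewrite [LHS]pres_mulE; apply/pres_eqP/PresRelator/VertexRelator.
Qed.

Lemma coxeter_genV v : (g v)^-1 = g v.
Proof. exact/mulg1_eq/coxeter_genM. Qed.

Lemma coxeter_genK v : involutive ( *%g (g v)).
Proof. by move=> x; rewrite mulgA coxeter_genM mul1g. Qed.

Lemma coxeter_genKr v : involutive ( *%g^~ (g v)).
Proof. by move=> x; rewrite -mulgA coxeter_genM mulg1. Qed.

Lemma coxeter_genX u v (uv : edge u v) : (g u * g v) ^+ edge_label u v = 1.
Proof.
transitivity (\pi_(presented (@coxeter_relator Gamma))
    (flatten (nseq (edge_label u v) [:: (u, true); (v, true)]))).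
  elim: (edge_label u v) => [|n IHn]; first by rewrite expg0.
  rewrite expgS IHn /= -[RHS](@pres_mulE _ _ [:: _; _]); congr (_ * _).
  by rewrite [LHS]pres_mulE.
by apply/pres_eqP/PresRelator/EdgeRelator.
Qed.

Lemma coxeter_prod_eq s s' : P s = P s' ->
  pres_eq (@coxeter_relator Gamma) [seq (v, true) | v <- s] [seq (v, true) | v <- s'].
Proof.
have E t : P t = \pi_(presented (@coxeter_relator Gamma)) [seq (v, true) | v <- t].
  by rewrite pres_wordE /word_eval big_map.
by rewrite !E => /pres_eqP.
Qed.

Lemma coxeter_prod_rev s : P (rev s) = (P s)^-1.
Proof.
elim: s => [|v s IHs]; first by rewrite big_nil invg1.
by rewrite rev_cons -cats1 big_cat big_seq1 big_cons invgM IHs coxeter_genV.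
Qed.

Lemma coxeter_prod_ex x : exists s, P s == x.
Proof.
rewrite -(reprK x); exists [seq a.1 | a <- repr x]; apply/eqP.
rewrite pres_wordE /word_eval big_map; apply: eq_bigr => -[v b] _ /=.
by case: b => //; rewrite coxeter_genV.
Qed.

(* Counts modulo 2, in [p.2], how often [p.1] occurs among the reflections
   [s_1 .. s_(i-1) s_i s_(i-1) .. s_1] of a word [s_1 .. s_k], when the letters
   are processed from left to right. *)
Definition reflection_flip (p : W * bool) v : W * bool :=
  (g v * p.1 * g v, p.2 (+) (p.1 == g v)).

Lemma reflection_flipK v : involutive (reflection_flip^~ v).
Proof.
case=> r b; rewrite /reflection_flip /=; congr pair.
  by rewrite !mulgA coxeter_genM mul1g coxeter_genKr.
rewrite -addbA (_ : (g v * r * g v == g v) = (r == g v)) ?addbb ?addbF //.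
apply/eqP/eqP => [|->]; last by rewrite coxeter_genM mul1g.
move/(congr1 (fun y => g v * y * g v)).
by rewrite !mulgA coxeter_genM mul1g coxeter_genKr mul1g.
Qed.

(** Conjugating each letter of the alternating word [u v u v ...] by its prefix gives the
    reflections [c ^+ j * g u] with [c = g u * g v], because [g u] inverts [c] (this is [cJ]). *)
Lemma reflection_flip_iter u v n r b :
  iter n (fun p => reflection_flip (reflection_flip p u) v) (r, b) =
  ((g u * g v) ^- n * r * (g u * g v) ^+ n,
   b (+) \big[addb/false]_(0 <= j < n.*2) (r == (g u * g v) ^+ j * g u)).
Proof.
set c := g u * g v.
have cV : c^-1 = g v * g u by rewrite /c invgM !coxeter_genV.
have cJ m : g u * c ^- m = c ^+ m * g u.
  elim: m => [|m IHm]; first by rewrite expg0 invg1 mulg1 mul1g.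
  rewrite [in LHS]expgS invgM mulgA IHm -mulgA cV [g u * _]mulgA -/c.
  by rewrite mulgA -expgSr.
have conj_eq (y z : W) : (y^-1 * r * y == z) = (r == y * z * y^-1).
  apply/eqP/eqP => [<-|->]; first by rewrite !mulgA mulgV mul1g mulgK.
  by rewrite !mulgA mulVg mul1g mulgVK.
elim: n => [|n IHn]; first by rewrite big_geq // addbF expg0 invg1 mulg1 mul1g.
rewrite iterS IHn /reflection_flip /=; congr pair.
  by rewrite expgSr invgM cV !mulgA.
rewrite doubleS !big_nat_recr //= !addbA; congr (_ (+) _ (+) _).
  by rewrite conj_eq -mulgA cJ mulgA -expgnDr addnn.
have -> : g u * (c ^- n * r * c ^+ n) * g u = (c ^+ n * g u)^-1 * r * (c ^+ n * g u).
  by rewrite invgM coxeter_genV !mulgA.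
rewrite conj_eq invgM coxeter_genV -!mulgA cJ [g u * _]mulgA -/c mulgA.
by rewrite -expgSr mulgA -expgnDr addSn addnn.
Qed.

(** A relator [(u v)^m] has the [2m] reflections [(g u * g v) ^+ j * g u]. Since
    [(g u * g v) ^+ m = 1], the indices [j] and [j + m] give the same one, so every reflection
    occurs an even number of times. *)
Lemma reflection_flip_relator r p :
  coxeter_relator r -> foldl (fun p a => reflection_flip p a.1) p r = p.
Proof.
case=> [v|u v uv] /=; first exact: reflection_flipK.
set m := edge_label u v.
have -> : foldl (fun p a => reflection_flip p a.1) p
      (flatten (nseq m [:: (u, true); (v, true)])) =
    iter m (fun p => reflection_flip (reflection_flip p u) v) p.
  by elim: m p => [//|m IHm] p; rewrite iterSr -IHm.
case: p => r' b; rewrite reflection_flip_iter coxeter_genX // invg1 mul1g mulg1.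
rewrite -addnn (@big_cat_nat _ _ _ m) ?leq_addr //=.
set F := fun j => r' == (g u * g v) ^+ j * g u.
have -> : \big[addb/false]_(m <= j < m + m) F j = \big[addb/false]_(0 <= j < m) F j.
  rewrite -{1}[m]add0n big_addn addnK; apply: eq_bigr => j _.
  by rewrite /F expgnDr coxeter_genX // mulg1.
by rewrite addbb addbF.
Qed.

(** The flips respect the defining relations, so they form an action of [W]: the parity with which a
    reflection occurs in a word is an invariant of the group element. *)
Lemma reflection_flip_prod s s' p :
  P s = P s' -> foldl reflection_flip p s = foldl reflection_flip p s'.
Proof.
move=> /coxeter_prod_eq ss'.
have foldE t q : foldl reflection_flip q t =
    foldl (fun q a => reflection_flip q a.1) q [seq (v, true) | v <- t].
  by elim: t q => [//|v t IHt] q; exact: IHt.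
rewrite !foldE; elim: ss' p.
- by [].
- by move=> u v _ IH p; rewrite IH.
- by move=> u v w _ IHu _ IHv p; rewrite IHu.
- by move=> u u' v v' _ IHu _ IHv p; rewrite !foldl_cat IHu IHv.
- by move=> x b p; exact: reflection_flipK.
- by move=> r rP p; exact: reflection_flip_relator.
Qed.

Lemma reflection_flip_addb s r b :
  (foldl reflection_flip (r, b) s).2 = b (+) (foldl reflection_flip (r, false) s).2.
Proof.
elim: s r b => [|v s IHs] r b; first by rewrite addbF.
by rewrite /= {1 3}/reflection_flip /= IHs [in RHS]IHs addbA.
Qed.

Lemma reflection_flip_true s r b : (foldl reflection_flip (r, b) s).2 != b ->
  exists s1 v s2, s = s1 ++ v :: s2 /\ r = P s1 * g v * (P s1)^-1.
Proof.
elim: s r b => [|v s IHs] r b; first by rewrite eqxx.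
rewrite [foldl _ _ _]/= {2}/reflection_flip /=.
have [-> _|_] := eqVneq r (g v).
  by exists [::], v, s; rewrite big_nil invg1 mulg1 mul1g.
rewrite addbF => /IHs[s1 [u [s2 [-> E]]]]; exists (v :: s1), u, s2; split=> //.
rewrite big_cons invgM coxeter_genV.
move/(congr1 (fun y => g v * y * g v)): E.
by rewrite !mulgA coxeter_genM mul1g coxeter_genKr.
Qed.

Fact coxeter_len_subproof x : exists n, `[< exists2 s, P s = x & size s = n >].
Proof.
by have [s /eqP sx] := coxeter_prod_ex x; exists (size s); apply/asboolP; exists s.
Qed.

Definition coxeter_len x : nat := ex_minn (coxeter_len_subproof x).
Notation len := coxeter_len.

Lemma coxeter_len_prod s : len (P s) <= size s.
Proof.
by rewrite /len; case: ex_minnP => m _; apply; apply/asboolP; exists s.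
Qed.

Lemma coxeter_reduced x : exists2 s, P s = x & size s = len x.
Proof. by rewrite /len; case: ex_minnP => m /asboolP. Qed.

Lemma coxeter_len1 : len 1 = 0.
Proof. by apply/eqP; rewrite -leqn0; have := coxeter_len_prod [::]; rewrite big_nil. Qed.

Lemma coxeter_len0 x : len x = 0 -> x = 1.
Proof.
by have [s <- <-] := coxeter_reduced x; move=> /size0nil ->; rewrite big_nil.
Qed.

Lemma coxeter_lenV x : len x^-1 = len x.
Proof.
have le y : len y^-1 <= len y.
  have [s <- <-] := coxeter_reduced y.
  by rewrite -coxeter_prod_rev -size_rev coxeter_len_prod.
by apply/eqP; rewrite eqn_leq le -{1}[x]invgK le.
Qed.

Lemma coxeter_lenM x y : len (x * y) <= len x + len y.
Proof.
have [[s <- <-] [t <- <-]] := (coxeter_reduced x, coxeter_reduced y).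
by rewrite -big_cat -size_cat coxeter_len_prod.
Qed.

Lemma coxeter_len_gen v : len (g v) <= 1.
Proof. by have := coxeter_len_prod [:: v]; rewrite big_seq1. Qed.

Lemma coxeter_len_genM v x : len (g v * x) <= (len x).+1.
Proof. by rewrite (leq_trans (coxeter_lenM _ _)) // -add1n leq_add2r coxeter_len_gen. Qed.

Lemma coxeter_len_le_genM v x : len x <= (len (g v * x)).+1.
Proof. by rewrite -{1}[x](coxeter_genK v) coxeter_len_genM. Qed.

(* If [g v] does not occur among the reflections of [s], it occurs among those
   of [v :: s], hence of a reduced word for [g v * P s], and the deletion there
   shows that [P s] is shorter. *)
Lemma coxeter_exchange v s : len (g v * P s) <= len (P s) ->
  exists s1 u s2, s = s1 ++ u :: s2 /\ g v * P s = P (s1 ++ s2).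
Proof.
have deletion t : (foldl reflection_flip (g v, false) t).2 ->
    exists s1 u s2, t = s1 ++ u :: s2 /\ g v * P t = P (s1 ++ s2).
  move=> tv; have [|s1 [u [s2 [-> ->]]]] := @reflection_flip_true t (g v) false.
    by rewrite tv.
  exists s1, u, s2; split=> //.
  by rewrite !big_cat big_cons /= !mulgA mulgVK coxeter_genKr.
case: (boolP (foldl reflection_flip (g v, false) s).2) => [/deletion //|sv le_len].
have [t tE tlen] := coxeter_reduced (g v * P s).
have /deletion[s1 [u [s2 [tD]]]] : (foldl reflection_flip (g v, false) t).2.
  rewrite (@reflection_flip_prod t (v :: s)) ?big_cons //=.
  by rewrite /reflection_flip /= eqxx coxeter_genM mul1g reflection_flip_addb.
rewrite tE coxeter_genK => sE; move: le_len; rewrite -tlen sE tD.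
by rewrite size_cat /= addnS -size_cat ltnNge coxeter_len_prod.
Qed.

(** The two cases tell which factor the exchanged letter is deleted from. When it lies in [s],
    cancelling [P t] on the right leaves an identity about [s] alone. *)
Lemma coxeter_exchange_cat v s t : len (g v * P (s ++ t)) <= len (P (s ++ t)) ->
  (exists s', [/\ subseq s' s, size s' < size s & g v * P s = P s']) \/
  (exists t', [/\ subseq t' t, size t' < size t & g v * P (s ++ t) = P (s ++ t')]).
Proof.
move=> /coxeter_exchange[s1 [u [s2 [stE]]]].
have subD (r1 r2 : seq Gamma) : subseq (r1 ++ r2) (r1 ++ u :: r2).
  by rewrite cat_subseq // subseq_cons.
have ltD (r1 r2 : seq Gamma) : size (r1 ++ r2) < size (r1 ++ u :: r2).
  by rewrite !size_cat /= addnS.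
have [lt|ge] := ltnP (size s1) (size s).
  have sE : s = s1 ++ u :: drop (size s1).+1 s.
    rewrite -[LHS](cat_take_drop (size s1)) (drop_nth u) //.
    have -> : nth u s (size s1) = u.
      by have := congr1 (fun r => nth u r (size s1)) stE; rewrite !nth_cat lt ltnn subnn.
    congr (_ ++ _).
    by have := congr1 (take (size s1)) stE; rewrite takel_cat 1?ltnW // take_size_cat.
  move: stE; rewrite {1}sE -catA => /eqP.
  rewrite eqseq_cat // => /andP[_ /eqP[<-]].
  rewrite catA !big_cat /= mulgA => /mulIg; rewrite -big_cat => E.
  by left; exists (s1 ++ drop (size s1).+1 s);
    split=> //; [rewrite {2}sE | rewrite {2}sE].
have s1E : s1 = s ++ drop (size s) s1.
  rewrite -[LHS](cat_take_drop (size s)); congr (_ ++ _).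
  by have := congr1 (take (size s)) stE; rewrite take_size_cat // takel_cat.
move: stE; rewrite s1E -!catA => /eqP; rewrite eqseq_cat // => /andP[_ /eqP ->] E.
by right; exists (drop (size s) s1 ++ s2).
Qed.

Lemma coxeter_len_genM_neq v x : len (g v * x) <= len x -> len (g v * x) < len x.
Proof.
have [s <- ss] := coxeter_reduced x.
move=> /coxeter_exchange[s1 [u [s2 [sD ->]]]].
by rewrite -ss sD size_cat /= addnS ltnS -size_cat coxeter_len_prod.
Qed.

(** Letters are added on the left to a reduced word. If the new letter does not increase the length,
    exchange cancels it against a letter of [t], and what remains is reduced since a generator
    changes the length by at most one. *)
Lemma coxeter_subreduced s :
  exists t, [/\ subseq t s, P t = P s & size t = len (P s)].
Proof.
elim: s => [|v s [t [ts tP tl]]]; first by exists [::]; rewrite big_nil coxeter_len1.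
have [le|lt] := leqP (len (g v * P t)) (len (P t)).
  have /coxeter_exchange[t1 [u [t2 [tD tE]]]] := le.
  exists (t1 ++ t2); rewrite big_cons -tP tE; split=> //.
    rewrite (subseq_trans _ (subseq_cons s v)) // (subseq_trans _ ts) // tD.
    by rewrite cat_subseq // subseq_cons.
  apply/eqP; rewrite eqn_leq coxeter_len_prod andbT -tE -ltnS.
  rewrite (leq_trans _ (coxeter_len_le_genM v _)) // tP -tl tD.
  by rewrite !size_cat /= addnS.
exists (v :: t); rewrite !big_cons -tP /= eqxx; split=> //.
apply/eqP; rewrite eqn_leq tl tP in lt *.
by rewrite lt coxeter_len_genM.
Qed.

(** * Special subgroups, descents and longest elements *)

Lemma coxeter_gen_special A v : v \in A -> g v \in special A.
Proof. by move=> vA; apply/asboolP => S AS; apply: AS; exists v. Qed.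

Lemma special_prod A s : {subset s <= A} -> P s \in special A.
Proof.
move=> sA; rewrite big_seq; apply: gpred_prod => v vs.
exact/coxeter_gen_special/sA.
Qed.

(** Products of words in [A] form a subgroup [S'], and reducing by deletion introduces no new
    letters. Hence the length of [W_A] is the restriction of that of [W]. *)
Lemma special_reduced A x : x \in special A ->
  exists s, [/\ {subset s <= A}, P s = x & size s = len x].
Proof.
pose S : {pred W} := fun y => `[< exists2 s, {subset s <= A} & P s = y >].
have SM : mulg_closed S.
  move=> y z /asboolP[s sA <-] /asboolP[t tA <-]; apply/asboolP.
  exists (s ++ t); last by rewrite big_cat.
  by move=> v; rewrite mem_cat => /orP[/sA|/tA].
have S1 : 1 \in S by apply/asboolP; exists [::]; rewrite ?big_nil.
have SV : invg_closed S.
  move=> y /asboolP[s sA <-]; apply/asboolP; exists (rev s).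
    by move=> v; rewrite mem_rev => /sA.
  by rewrite coxeter_prod_rev.
pose S' : groupClosed W := HB.pack S (isMulClosed.Build W S SM)
  (isMul1Closed.Build W S S1) (isInvClosed.Build W S SV).
move=> /asboolP /(_ S') xS'; have /asboolP[s sA <-] : x \in S.
  apply: xS' => _ [v vA <-]; apply/asboolP; exists [:: v]; rewrite ?big_seq1 //.
  by move=> u; rewrite inE => /eqP ->.
have [t [ts tP tl]] := coxeter_subreduced s.
by exists t; split=> // v /(mem_subseq ts)/sA.
Qed.

Lemma special_sub A (B : {set Gamma}) : A \subset B -> {subset special A <= special B}.
Proof.
move=> /fintype.subsetP AB x /special_reduced[s [sA <- _]].
by apply: special_prod => v /sA/AB.
Qed.

Lemma special_setT x : x \in special [set: Gamma].
Proof.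
have [s /eqP <-] := coxeter_prod_ex x.
by apply: special_prod => v _; rewrite finset.in_setT.
Qed.

Definition left_descents A w : {set Gamma} :=
  [set v in A | len (g v * w) < len w].

Lemma left_descents_sub A w : left_descents A w \subset A.
Proof. by apply/fintype.subsetP => v; rewrite inE => /andP[]. Qed.

(** Every element of [W_I] is an initial piece of [w] with lengths adding up. In particular lengths
    in [W_I] are bounded by that of [w], so [W_I] is finite. *)
Lemma descent_len I w x :
    (forall v, v \in I -> len (g v * w) < len w) -> x \in special I ->
  len (x^-1 * w) + len x = len w.
Proof.
move=> desc /special_reduced[s [sI <-]].
elim: s sI => [|v s IHs] sI slen.
  by rewrite big_nil invg1 mul1g coxeter_len1 addn0.
have s_red : size s = len (P s).
  apply/eqP; rewrite eqn_leq coxeter_len_prod andbT -ltnS.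
  by rewrite [_.+1]slen big_cons coxeter_len_genM.
have {}IHs := IHs (fun u us => sI u (mem_behead (s := v :: s) us)) s_red.
have [c cE clen] := coxeter_reduced ((P s)^-1 * w).
have wE : w = P (s ++ c) by rewrite big_cat cE /= mulVKg.
have vw := desc v (sI v (mem_head _ _)).
apply/eqP; rewrite eqn_leq; apply/andP; split; last first.
  by rewrite -{1}[w](mulVKg (P (v :: s))) addnC coxeter_lenM.
(* Exchange cannot delete a letter of [s], as [v :: s] is reduced. So it shortens [c], which
   represents what is left of [w] after removing [P s]. *)
have : len (g v * P (s ++ c)) <= len (P (s ++ c)) by rewrite -wE ltnW.
case/coxeter_exchange_cat => [[s' [_ lt_s' E]]|[c' [_ lt_c' E]]].
  move: slen; rewrite big_cons E => /= slen.
  by have := leq_trans lt_s' (leqnSn _); rewrite slen ltnNge coxeter_len_prod.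
rewrite -slen big_cons invgM coxeter_genV -mulgA {1}wE E big_cat mulKg /= addnS -addSn.
rewrite -IHs -s_red leq_add2r -clen.
exact: leq_ltn_trans (coxeter_len_prod c') lt_c'.
Qed.

Lemma max_len_special I n : (forall x, x \in special I -> len x <= n) ->
  exists2 x, x \in special I & forall y, y \in special I -> len y <= len x.
Proof.
move=> bounded.
have ex0 : exists m, `[< exists2 x, x \in special I & len x = m >].
  by exists (len 1); apply/asboolP; exists 1 => //; exact: gpred1.
have bd m : `[< exists2 x, x \in special I & len x = m >] -> m <= n.
  by case/asboolP => x xI <-; exact: bounded.
case: (ex_maxnP ex0 bd) => m /asboolP[x xI <-] max_x.
by exists x => // y yI; apply: max_x; apply/asboolP; exists y.
Qed.

(* [w] is the longest element [x] of W_I: a right descent of [x^-1 * w] would be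
   one of [w], hence also a descent of [x], although the product
   [(x^-1 * w) * x] is reduced. *)
Lemma descent_commute_special A w (I := left_descents A w) :
    w \in special A -> (forall v, v \in I -> commute (g v) w) ->
    (forall v, v \in A -> len (w * g v) < len w -> v \in I) ->
  w \in special I.
Proof.
move=> wA comm rdesc.
have ldesc v : v \in I -> len (g v * w) < len w by rewrite inE => /andP[].
have [|x xI max_x] := @max_len_special I (len w).
  by move=> x xI; rewrite -(descent_len ldesc xI) leq_addl.
have xw : commute x w.
  have [s [sI <- _]] := special_reduced xI.
  apply: commute_sym; rewrite big_seq; apply: commute_prod => v vs.
  exact/commute_sym/comm/sI.
have lenw := descent_len ldesc xI; set u := x^-1 * w in lenw.
have wE : w = u * x by rewrite /u -mulgA -xw mulKg.
have uA : u \in special A.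
  rewrite /u gpredM // gpredVr // (special_sub _ xI) //.
  exact: left_descents_sub.
have [s [sA sE slen]] := special_reduced uA.
have [s0|[s' [t sD]]] : s = [::] \/ exists s' t, s = rcons s' t.
  by case: (lastP s) => [|s' t]; [left | right; exists s', t].
  by rewrite wE -sE s0 big_nil mul1g.
have lt_ut : len (u * g t) < len u.
  rewrite -slen -sE sD -cats1 big_cat big_seq1 /= coxeter_genKr size_cat addn1 ltnS.
  exact: coxeter_len_prod.
have tI : t \in I.
  apply: rdesc; first by rewrite sA // sD mem_rcons mem_head.
  have -> : w * g t = x * (u * g t) by rewrite mulgA /u mulVKg.
  by rewrite (leq_ltn_trans (coxeter_lenM _ _)) // addnC -lenw ltn_add2r.
have lt_tx : len (g t * x) < len x.
  apply: coxeter_len_genM_neq; apply: max_x.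
  by rewrite gpredM // coxeter_gen_special.
(* Both factors of [w = (u * g t) * (g t * x)] are shorter than [u] and [x], contradicting
   [lenw]. *)
have := coxeter_lenM (u * g t) (g t * x).
rewrite mulgA coxeter_genKr -wE -lenw leqNgt.
by rewrite -addSn leq_add // ltnW.
Qed.

(** This is uniqueness of the longest element of [W_I]: by [descent_len] each of [w], [w'] is an
    initial piece of the other, so the lengths agree and [w'^-1 * w] has length 0. *)
Lemma descent_special_inj I w w' :
    w \in special I -> w' \in special I ->
    (forall v, v \in I -> len (g v * w) < len w) ->
    (forall v, v \in I -> len (g v * w') < len w') ->
  w = w'.
Proof.
move=> wI w'I desc desc'.
have le := descent_len desc w'I; have le' := descent_len desc' wI.
have lenE : len w' = len w.
  apply/eqP; rewrite eqn_leq.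
  by rewrite -[X in (_ <= X) && _]le -[X in _ && (_ <= X)]le' !leq_addl.
apply/(mulgI w'^-1); rewrite mulVg; apply: coxeter_len0.
by apply/eqP; rewrite -(eqn_add2r (len w')) le lenE.
Qed.

(** * Conjugacy classes of involutions *)

Lemma involution_descent w v : w * w = 1 ->
    (forall x, len w <= len (w ^ x)) -> len (g v * w) < len w ->
  commute (g v) w.
Proof.
move=> ww min_w lt_vw.
have [s sE slen] := coxeter_reduced (g v * w).
have wE : w = P (rev s ++ [:: v]).
  rewrite big_cat coxeter_prod_rev sE invgM big_seq1 /= coxeter_genV coxeter_genKr.
  by rewrite (mulg1_eq ww).
have lenw : len w = (size s).+1.
  by apply/eqP; rewrite slen eqn_leq lt_vw coxeter_len_le_genM.
(* Deleting a letter of [rev s] would make the conjugate [g v * w * g v] shorter than [w]. So the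
   final [v] is deleted, and [g v * w = P (rev s) = w * g v]. *)
have := ltnW lt_vw; rewrite {1 2}wE => /coxeter_exchange_cat[[s' [_]]|[t [_]]].
  rewrite size_rev => lt_s' E.
  have := min_w (g v); rewrite conjgE coxeter_genV {2}wE big_cat big_seq1 /=.
  rewrite coxeter_genKr E lenw ltnNge => /negP[].
  rewrite (leq_trans _ (ltnW lt_s')) // coxeter_len_prod //.
case: t => // _; rewrite cats0 -wE coxeter_prod_rev sE invgM coxeter_genV.
by rewrite (mulg1_eq ww).
Qed.

(** [F w] is the descent set of a conjugate of [w] of minimal length. That conjugate is the longest
    element of the special subgroup on [F w], so [F w] determines it. As [F] has finitely many
    values, there are finitely many classes. *)
Lemma involution_classes : exists F : W -> {set Gamma}, forall w w',
  w * w = 1 -> w' * w' = 1 -> F w = F w' -> exists x, w' = w ^ x.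
Proof.
have min_conj w : exists x, forall y, len (w ^ x) <= len (w ^ y).
  have ex0 : exists m, `[< exists y, len (w ^ y) = m >].
    by exists (len (w ^ 1)); apply/asboolP; exists 1.
  case: (ex_minnP ex0) => m /asboolP[x <-] min_x.
  by exists x => y; apply: min_x; apply/asboolP; exists y.
have [m mP] := choice min_conj.
pose N w := w ^ m w; pose F w := left_descents [set: Gamma] (N w).
have FP w : w * w = 1 -> N w \in special (F w) /\
    forall v, v \in F w -> len (g v * N w) < len (N w).
  move=> ww; have NN : N w * N w = 1 by rewrite /N -conjMg ww conj1g.
  split=> [|v]; last by rewrite inE => /andP[].
  apply: descent_commute_special => [|v|v _].
  - exact: special_setT.
  - rewrite inE => /andP[_]; apply: involution_descent => // x.
    by rewrite /N -conjgM; exact: mP.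
  (* Right descents are left descents because [N w] is its own inverse. *)
  - rewrite inE finset.in_setT -[len (_ * g v)]coxeter_lenV invgM coxeter_genV.
    by rewrite (mulg1_eq NN).
exists F => w w' /FP[wF descw] /FP[wF' descw'] FE.
rewrite -FE in wF' descw'; have := descent_special_inj wF wF' descw descw'.
by move/(congr1 (conjg^~ (m w')^-1)); rewrite -conjgM conjgK => <-; exists (m w / m w').
Qed.

(** * Descents of central elements *)

Lemma coxeter_gen_special_inv I v :
  g v \in special I -> g v <> 1 -> exists2 u, u \in I & g u = g v.
Proof.
move=> /special_reduced[s [sI sE slen]] v1.
case: s => [|u [|u' s]] in sI sE slen.
- by case: v1; rewrite -sE big_nil.
- by exists u; [exact: sI (mem_head _ _) | rewrite -sE big_seq1].
- by have := coxeter_len_gen v; rewrite -slen.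
Qed.

(* If [g u] and [g v] did not commute, [g v * g u * g v] would have length 3 and
   hence [v] as a descent; but it lies in W_I, whose elements only have descents
   in [I]. *)
Lemma central_descents A w (I := left_descents A w) :
    w \in special A -> (forall v, v \in A -> commute (g v) w) ->
  forall u v, u \in I -> v \in A -> v \notin I -> commute (g u) (g v) /\ g u <> g v.
Proof.
move=> wA comm u v uI vA vI.
have [uA lt_u] : u \in A /\ len (g u * w) < len w by move: uI; rewrite inE => /andP.
have lt_v : len w < len (g v * w).
  rewrite ltnNge; apply: contra vI => /coxeter_len_genM_neq.
  by rewrite inE vA.
have neq_uv : g u <> g v by move=> E; move: lt_u; rewrite E ltnNge ltnW.
split=> //.
have u1 : g u <> 1 by move=> E; move: lt_u; rewrite E mul1g ltnn.
have v1 : g v <> 1 by move=> E; move: lt_v; rewrite E mul1g ltnn.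
have wI : w \in special I.
  apply: descent_commute_special => // [z|z zA].
    by rewrite inE => /andP[/comm].
  by rewrite inE zA (comm _ zA).
(* Since [w] commutes with [g v], the generator [g u] does not lengthen [g v * w], and exchange
   applies to the word [v :: s]. Deleting [v] would give [g u = g v]. Hence
   [g u * g v * w = g v * P t] with [t] a word in [I]. *)
have rI : g v * g u * g v \in special I.
  have [s [sI sE _]] := special_reduced wI.
  have : len (g u * P (v :: s)) <= len (P (v :: s)).
    rewrite big_cons sE (comm _ vA) mulgA (leq_trans (coxeter_lenM _ _)) //.
    rewrite -(comm _ vA) (leq_trans _ lt_v) // leqW // (leq_trans _ lt_u) //.
    by rewrite -addn1 leq_add2l coxeter_len_gen.
  case/(@coxeter_exchange_cat _ [:: v])=> [[[|z t] [_ lt_t]]|[t [ts _]]] //.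
    rewrite big_seq1 big_nil => /(congr1 ( *%g (g u))).
    by rewrite coxeter_genK mulg1 => /esym/neq_uv.
  rewrite big_cons -/(P s) [P (_ ++ t)]big_cons sE => E.
  have -> : g v * g u * g v = P t * w^-1.
    apply: (mulIg w); rewrite mulgVK; apply: (mulgI (g v)).
    by rewrite -E !mulgA coxeter_genM mul1g.
  by rewrite gpredM ?gpredV // special_prod // => z /(mem_subseq ts)/sI.
set r := g v * g u * g v in rI.
have vr : g v * r = g u * g v by rewrite /r !mulgA coxeter_genM mul1g.
(* If [g v] did not lengthen [r], exchange would put [g v * r], hence [g v], into [W_I], making
   [g v] a descent of [w]. So [r] is shorter than [g v * r = g u * g v], whose length is at most
   2. *)
have lenr : len r <= 1.
  have [s [sI sE slen]] := special_reduced rI.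
  have [le|lt] := leqP (len (g v * P s)) (len (P s)).
    have [s1 [z [s2 [sD E]]]] := coxeter_exchange le.
    have vI' : g v \in special I.
      rewrite -(gpredMr _ rI) -sE E special_prod // => x xs; apply: sI.
      by move: xs; rewrite sD !mem_cat inE => /orP[->|->]; rewrite ?orbT.
    have [z' z'I E'] := coxeter_gen_special_inv vI' v1.
    by move: z'I lt_v; rewrite inE -E' => /andP[_ /ltnW]; rewrite leqNgt => /negP.
  rewrite -ltnS -{1}sE (leq_trans lt) // sE vr.
  rewrite (leq_trans (coxeter_lenM _ _)) //.
  exact: leq_add (coxeter_len_gen _) (coxeter_len_gen _).
(* A reduced subword of [v u v] for [r] has at most one letter: the empty word gives [g u = 1], the
   letter [v] gives [g u = g v], and the letter [u] gives commutation. *)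
have [t [ts tE tlen]] := coxeter_subreduced [:: v; u; v].
have rE : P t = r by rewrite tE !big_cons big_nil mulg1 mulgA.
have : size t <= 1 by rewrite tlen -tE rE.
case: t => [|z [|//]] in ts rE {tE tlen} * => _.
  have : g u * g v = g v by rewrite -vr -rE big_nil mulg1.
  by rewrite -[RHS]mul1g => /mulIg.
have : z \in [:: v; u; v] by exact: mem_subseq ts _ (mem_head _ _).
rewrite big_seq1 in rE; rewrite !inE => /or3P[] /eqP zE; rewrite zE in rE.
- move: vr; rewrite -rE coxeter_genM => /(congr1 ( *%g (g u))).
  by rewrite coxeter_genK mulg1 => /neq_uv.
- by rewrite /commute -vr -rE.
- move: vr; rewrite -rE coxeter_genM => /(congr1 ( *%g (g u))).
  by rewrite coxeter_genK mulg1 => /neq_uv.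
Qed.

Lemma bounded_finite n : finite_set [set x : W | len x <= n]%classic.
Proof.
apply: (@sub_finite_set _ _ ((fun s : n.-bseq Gamma => P s) @` setT)%classic).
  move=> x /= xn; have [s sE slen] := coxeter_reduced x.
  have sn : size s <= n by rewrite slen.
  by exists (Bseq sn).
exact/finite_image/finite_finset.
Qed.

End CoxeterLength.

Lemma infinite_subgroup (G : groupType) (S : groupClosed G) :
  infinite_group (subgroup S) <-> infinite_set [set x | x \in S]%classic.
Proof.
split=> inf fin; apply: inf.
  apply: (@sub_finite_set _ _ ((val : subgroup S -> G) @^-1` [set x | x \in S])%classic).
    by move=> x _; exact: valP.
  by apply: finite_preimage fin => x y _ _; exact: val_inj.
apply: sub_finite_set (finite_image (val : subgroup S -> G) fin) => x xS.
by exists (Sub x xS).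
Qed.

(** * Direct factors and centres of special subgroups *)

Section SpecialCenter.
Variable Gamma : coxeterGraph.
Notation W := (coxeterGroup Gamma).
Notation g := (@coxeter_gen Gamma).
Implicit Types (A B : {set Gamma}) (w : W).

Lemma special_mul_commute A B x :
    (forall u v, u \in A -> v \in B -> commute (g u) (g v)) ->
    x \in special (A :|: B)%SET ->
  exists a b, [/\ a \in special A, b \in special B & x = a * b].
Proof.
move=> comm /special_reduced[s [sAB <- _]] {x}.
elim: s sAB => [|v s IHs] sAB.
  by exists 1, 1; rewrite !gpred1 mulg1 big_nil.
have [u us|a [b [aA bB E]]] := IHs; first by rewrite sAB // inE us orbT.
rewrite big_cons E; have := sAB v (mem_head _ _); rewrite finset.in_setU => /orP[vA|vB].
  by exists (g v * a), b; rewrite mulgA gpredM // coxeter_gen_special.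
exists a, (g v * b); rewrite gpredM // ?coxeter_gen_special //; split=> //.
suff va : commute (g v) a by rewrite mulgA va mulgA.
have [t [tA <- _]] := special_reduced aA.
rewrite big_seq; apply: commute_prod => u /tA uA.
exact/commute_sym/comm.
Qed.

(** Commutation makes [W_B] a factor of [W_A]; the inequality [g u <> g v] serves to exclude odd
    labels between [B] and the rest of [A]. *)
Definition direct_part A B : Prop :=
  B \subset A /\ forall u v, u \in B -> v \in A -> v \notin B ->
    commute (g u) (g v) /\ g u <> g v.

(** [B] is an infinite direct part with fewest vertices. The descents [I] of a central [w] generate
    a finite factor, so the part on [B] minus [I] is still infinite. Minimality forces [I] to be
    empty, and [w], which lies in [W_I], is trivial. *)
Lemma infinite_centerless A : infinite_set [set x | x \in special A]%classic ->
  exists B, [/\ direct_part A B, infinite_set [set x | x \in special B]%classic &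
    forall w, w \in special B -> (forall v, v \in B -> commute (g v) w) -> w = 1].
Proof.
move=> Ainf; pose Q B :=
  `[< direct_part A B /\ infinite_set [set x | x \in special B]%classic >].
have QA : Q A.
  by apply/asboolP; split=> //; split=> // u v uA vA; rewrite vA.
case: (arg_minnP (fun B : {set Gamma} => #|B|) QA) => B /asboolP[[BA dirB] Binf] minB.
exists B; split=> // w wB comm.
have IB := left_descents_sub B w; set I := left_descents B w in IB.
have dir := central_descents wB comm; rewrite -/I in dir.
have wI : w \in special I.
  apply: descent_commute_special => // [z|z zB].
    by rewrite inE => /andP[/comm].
  by rewrite inE zB (comm _ zB).
have [I0|/finset.set0Pn[i iI]] := eqVneq I finset.set0.
  have [s [sI <- _]] := special_reduced wI.
  case: s sI => [|v s]; first by rewrite big_nil.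
  by move=> /(_ v (mem_head _ _)); rewrite I0 finset.in_set0.
have /minB : Q (B :\: I)%SET.
  apply/asboolP; split; first split.
  - exact: fintype.subset_trans (finset.subsetDl _ _) BA.
  - move=> u v /finset.setDP[uB uI] vA vBI.
    have [vB|vB] := boolP (v \in B); last exact: dirB.
    have vI : v \in I by move: vBI; rewrite finset.in_setD vB andbT negbK.
    by have [/commute_sym vu /nesym neq] := dir v u vI uB uI.
  - move=> fin; apply: Binf.
    have finI : finite_set [set x | x \in special I]%classic.
      apply: sub_finite_set (bounded_finite _ (coxeter_len w)) => x xI /=.
      by rewrite -(@descent_len _ I w x) ?leq_addl // => v; rewrite inE => /andP[].
    apply: sub_finite_set (finite_image2 (fun x y => x * y) fin finI) => x xB.
    have xBI : x \in special ((B :\: I) :|: I)%SET.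
      by rewrite finset.setUC -{1}(finset.setIidPr IB) finset.setID.
    have comm' u v : u \in (B :\: I)%SET -> v \in I -> commute (g u) (g v).
      by move=> /finset.setDP[uB uI] vI; have [/commute_sym] := dir v u vI uB uI.
    have [a [b [aB bI ->]]] := special_mul_commute comm' xBI.
    by exists a; [|exists b].
rewrite leqNgt => /negP[]; apply: proper_card.
rewrite finset.properEneq finset.subsetDl andbT; apply/negP => /eqP E.
by have := fintype.subsetP IB i iI; rewrite -E finset.in_setD iI.
Qed.

End SpecialCenter.

(** * Retractions onto special subgroups, and a finite index criterion *)

Section Retraction.
Variable Gamma : coxeterGraph.
Notation W := (coxeterGroup Gamma).
Notation g := (@coxeter_gen Gamma).
Implicit Types (A B : {set Gamma}).

Definition even_boundary A : Prop := forall u v : Gamma,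
  u \notin A -> v \in A -> edge u v -> ~~ odd (edge_label u v).

(** On an edge between [B] and the rest of [A] the generators are commuting involutions, so an odd
    label [m] would turn [(g u * g v) ^+ m = 1] into [g u = g v]. *)
Lemma even_boundary_direct_part A B :
  even_boundary A -> direct_part A B -> even_boundary B.
Proof.
move=> evenA [/fintype.subsetP BA dir] u v uB vB uv.
have [uA|uA] := boolP (u \in A); last exact: evenA (BA v vB) uv.
have [/commute_sym comm neq] := dir v u vB uA uB.
apply/negP => odd_m; apply: neq; have := coxeter_genX uv.
have genX w n : odd n -> g w ^+ n = g w.
  move=> odd_n; rewrite -[n]odd_double_half odd_n add1n expgS -muln2 mulnC expgnA.
  by rewrite expg2 coxeter_genM expg1n mulg1.
rewrite expgMn // !genX // => /mulg1_eq.
by rewrite coxeter_genV.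
Qed.

Lemma coxeter_morph_ext (G : groupType) (h h' : W -> G) :
    {morph h : x y / x * y} -> {morph h' : x y / x * y} ->
  (forall v, h (g v) = h' (g v)) -> h =1 h'.
Proof.
move=> hM h'M hE x; have [s /eqP <-] := coxeter_prod_ex x.
have morph1 (k : W -> G) : {morph k : y z / y * z} -> k 1 = 1.
  by move=> kM; apply: (mulgI (k 1)); rewrite -kM !mulg1.
elim: s => [|v s IHs]; first by rewrite big_nil !morph1.
by rewrite big_cons hM h'M hE IHs.
Qed.

(** Killing the vertices outside [A] respects the relators: on a boundary edge only a power of a
    single involution survives, and its exponent is even. *)
Lemma special_retraction A : even_boundary A ->
  exists rho : W -> W, [/\ {morph rho : x y / x * y},
    forall x, rho x \in special A, {in special A, forall x, rho x = x} &
    forall v, v \notin A -> rho (g v) = 1].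
Proof.
move=> evenA; pose h v : W := if v \in A then g v else 1.
have hh v : h v * h v = 1 by rewrite /h; case: ifP; rewrite ?coxeter_genM ?mulg1.
have hX v n : ~~ odd n -> h v ^+ n = 1.
  by move=> /even_halfK <-; rewrite -muln2 mulnC expgnA expg2 hh expg1n.
have [|rho rhoM rhoE] := @pres_lift _ (@coxeter_relator Gamma) W h.
  move=> r [v|u v uv]; first by rewrite /word_eval !big_cons big_nil mulg1 hh.
  transitivity ((h u * h v) ^+ edge_label u v).
    rewrite /word_eval; elim: (edge_label u v) => [|n IHn].
      by rewrite big_nil expg0.
    by rewrite /= !big_cons IHn expgS mulgA.
  have [uA|uA] := boolP (u \in A); have [vA|vA] := boolP (v \in A).
  - by rewrite /h uA vA coxeter_genX.
  - rewrite {2}/h (negPf vA) mulg1 hX // /edge_label finset.setUC.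
    by apply: evenA; rewrite // /edge finset.setUC.
  - by rewrite {1}/h (negPf uA) mul1g hX // evenA.
  - by rewrite /h (negPf uA) (negPf vA) mulg1 expg1n.
have rho1 : rho 1 = 1 by apply: (mulgI (rho 1)); rewrite -rhoM !mulg1.
exists rho; split=> // [x|x /special_reduced[s [sA <- _]]|v vA].
- have [s /eqP <-] := coxeter_prod_ex x; elim: s => [|v s IHs].
    by rewrite big_nil rho1 gpred1.
  rewrite big_cons rhoM gpredM // rhoE /h.
  by case: ifP => [/coxeter_gen_special|] //; rewrite gpred1.
- elim: s sA => [|v s IHs] sA; first by rewrite big_nil.
  rewrite big_cons rhoM IHs ?rhoE /h ?sA ?mem_head // => u us.
  by rewrite sA // inE us orbT.
- by rewrite rhoE /h (negPf vA).
Qed.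

End Retraction.

(** Finite index in two stages, read off from invariants with finitely many values. Dividing [x] by
    a representative of its [K0] class moves it into [S0], where [K1] separates the cosets of
    [S]. *)
Lemma finite_index_tower (G : groupType) (S0 : {pred G}) (S : groupClosed G)
    (T0 : Type) (T1 : Type) (K0 : G -> T0) (K1 : G -> T1) :
    finite_set [set: T0]%classic -> finite_set [set: T1]%classic ->
    (forall x y, K0 x = K0 y -> x^-1 * y \in S0) ->
    (forall x y, x \in S0 -> y \in S0 -> K1 x = K1 y -> x^-1 * y \in S) ->
  finite_index S.
Proof.
move=> fin0 fin1 K0S K1S.
have [r rP] : exists r : T0 -> G, forall x, K0 (r (K0 x)) = K0 x.
  have /choice[r rP] : forall t, exists z, forall x, K0 x = t -> K0 z = t.
    move=> t; have [[z zt]|no] := pselect (exists z, K0 z = t); first by exists z.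
    (* Values not attained by [K0] get the arbitrary representative 1. *)
    by exists 1 => x xt; case: no; exists x.
  by exists r => x; exact: rP.
pose K x := (K0 x, K1 ((r (K0 x))^-1 * x)).
have KS x y : K x = K y -> x^-1 * y \in S.
  case=> E0; rewrite /K -E0 => E1.
  have := K1S _ _ (K0S _ _ (rP x)) (K0S _ _ (etrans (rP x) E0)) E1.
  by rewrite invgM invgK -mulgA mulVKg.
have cosetE x y : K x = K y -> left_coset S x = left_coset S y.
  have sub u v : K u = K v -> (left_coset S u `<=` left_coset S v)%classic.
    move=> E z [h hS ->]; exists (v^-1 * u * h); last by rewrite !mulgA mulgV mul1g.
    by rewrite gpredM // KS.
  by move=> E; rewrite eqEsubset; split; apply: sub.
have [F FE] : exists F : T0 * T1 -> set G, forall x, F (K x) = left_coset S x.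
  have /choice[F FE] : forall t, exists C, forall x, K x = t -> C = left_coset S x.
    move=> t; have [[z zt]|no] := pselect (exists z, K z = t).
      by exists (left_coset S z) => x xt; apply: cosetE; rewrite zt.
    by exists set0 => x xt; case: no; exists x.
  by exists F => x; exact: FE.
apply: (@sub_finite_set _ _ (F @` ([set: T0] `*` [set: T1]))%classic).
  by move=> _ [x _ <-]; exists (K x) => //; exact: FE.
exact/finite_image/finite_setX.
Qed.

(** * Action of automorphisms on [W_Omega] through the retraction [rho] *)

Section VirtualSurjection.
Variables (Gamma : coxeterGraph) (Omega : {set Gamma}).
Notation W := (coxeterGroup Gamma).
Notation g := (@coxeter_gen Gamma).
Notation WO := (special Omega).
Variable rho : W -> W.
Hypotheses (rhoM : {morph rho : x y / x * y}) (rho_special : forall x, rho x \in WO)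
  (rho_id : {in WO, forall x, rho x = x})
  (rho_out : forall v, v \notin Omega -> rho (g v) = 1).
Implicit Types (f h : Aut W) (x y : W).

(* These automorphisms preserve the kernel of [rho], the normal closure of the
   vertices outside [Omega], so they act on W_Omega through [rho]. *)
Definition fix_outer_classes : {pred Aut W} :=
  fun f => `[< forall v, v \notin Omega -> exists x, f (g v) = g v ^ x >].

Fact aut_invVK f x : f^-1 (f x) = x.
Proof. by rewrite -autME mulVg. Qed.

Fact aut_KinvV f x : f (f^-1 x) = x.
Proof. by rewrite -autME mulgV. Qed.

Fact autJ f x y : f (x ^ y) = f x ^ f y.
Proof. exact: gmulfJ. Qed.

Fact fix_outer_classes1 : 1 \in fix_outer_classes.
Proof. by apply/asboolP => v _; exists 1; rewrite conjg1. Qed.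

Fact fix_outer_classesM : mulg_closed fix_outer_classes.
Proof.
move=> f h /asboolP fP /asboolP hP; apply/asboolP => v vO.
have [[x fE] [y hE]] := (fP v vO, hP v vO).
by exists (x * f y); rewrite autME hE autJ fE conjgM.
Qed.

Fact fix_outer_classesV : invg_closed fix_outer_classes.
Proof.
move=> f /asboolP fP; apply/asboolP => v vO; have [x fE] := fP v vO.
exists (f^-1 x)^-1; apply: (bij_inj (aut_bij f)).
by rewrite aut_KinvV autJ fE autV aut_KinvV conjgK.
Qed.

(** Both sides are homomorphisms in [x], so generators suffice. Those in [Omega] are fixed by [rho];
    for the others both sides are 1, since [f] sends them to conjugates. *)
Lemma rho_aut f x : f \in fix_outer_classes -> rho (f (rho x)) = rho (f x).
Proof.
move=> /asboolP fP; apply: (@coxeter_morph_ext _ _ (rho \o f \o rho) (rho \o f)) => /=.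
- by move=> y z /=; rewrite rhoM aut_morph rhoM.
- by move=> y z /=; rewrite aut_morph rhoM.
move=> v; have [vO|vO] := boolP (v \in Omega).
  by congr (rho (f _)); exact/rho_id/coxeter_gen_special.
have [y ->] := fP v vO.
have f1 : f 1 = 1 by exact: gmulf1.
by rewrite rho_out // f1 conjgE !rhoM rho_out // mul1g -rhoM mulVg.
Qed.

(** This will be the subgroup [H]. The conjugating element [a] is determined only up to the centre
    of [W_Omega]. *)
Definition inner_on_special : {pred Aut W} := fun f =>
  `[< f \in fix_outer_classes /\
      exists2 a, a \in WO & forall x, x \in WO -> rho (f x) = a * x / a >].

Fact inner_on_special1 : 1 \in inner_on_special.
Proof.
apply/asboolP; split; first exact: fix_outer_classes1.
by exists 1 => [|x xO]; rewrite ?gpred1 // aut1E rho_id // invg1 mulg1 mul1g.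
Qed.

Fact inner_on_specialM : mulg_closed inner_on_special.
Proof.
move=> f h /asboolP[fP [a aO aE]] /asboolP[hP [b bO bE]].
apply/asboolP; split; first exact: fix_outer_classesM.
exists (a * b) => [|x xO]; first by rewrite gpredM.
rewrite autME -rho_aut // bE // aE ?gpredM ?gpredV //.
by rewrite invgM !mulgA.
Qed.

Fact inner_on_specialV : invg_closed inner_on_special.
Proof.
move=> f /asboolP[fP [a aO aE]]; apply/asboolP; split; first exact: fix_outer_classesV.
exists a^-1 => [|x xO]; first by rewrite gpredV.
apply: (mulgI a); apply: (mulIg a^-1); rewrite -aE // rho_aut // aut_KinvV rho_id //.
by rewrite invgK !mulgA mulgV mul1g mulgK.
Qed.

HB.instance Definition _ := isMulClosed.Build (Aut W) inner_on_special inner_on_specialM.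
HB.instance Definition _ := isMul1Closed.Build (Aut W) inner_on_special inner_on_special1.
HB.instance Definition _ := isInvClosed.Build (Aut W) inner_on_special inner_on_specialV.

Definition inner_on_special_group : groupClosed (Aut W) := inner_on_special.

Lemma induced_aut f : f \in fix_outer_classes ->
  exists b : Aut (subgroup WO), forall x : subgroup WO, val (b x) = rho (f (val x)).
Proof.
move=> fP; pose bar h (x : subgroup WO) : subgroup WO :=
  Sub (rho (h (val x))) (rho_special _).
have barM h : {morph bar h : x y / x * y}.
  by move=> x y; apply: val_inj; rewrite valM /= aut_morph rhoM.
have barK h : h \in fix_outer_classes -> cancel (bar h^-1) (bar h).
  move=> hP x; apply: val_inj; rewrite /= rho_aut // aut_KinvV rho_id //; exact: valP.
(* By [rho_aut], the map induced by [f^-1] is inverse to the one induced by [f]. *)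
have bar_bij : bijective (bar f).
  exists (bar f^-1); last exact: barK.
  by rewrite -{1}[f]invgK; apply: barK; exact: fix_outer_classesV.
by exists (Automorphism (barM f) bar_bij).
Qed.

(** [K0] records the conjugacy classes of the involutions [f (g v)], and [K1] the outer class of the
    induced automorphism of [W_Omega]. *)
Lemma finite_index_inner_on_special :
  finite_group (Out (subgroup WO)) -> finite_index inner_on_special_group.
Proof.
move=> Out_finite; have [F FP] := involution_classes Gamma.
have /choice[b bP] : forall f, exists b : Aut (subgroup WO),
    f \in fix_outer_classes -> forall x : subgroup WO, val (b x) = rho (f (val x)).
  move=> f; have [/induced_aut[b bE]|fP] := boolP (f \in fix_outer_classes).
    by exists b.
  by exists 1.
pose K0 f := [ffun v : Gamma => F (f (g v))].
pose K1 f := (\pi_(Out (subgroup WO)) (b f))%qT.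
apply: (@finite_index_tower _ fix_outer_classes _ _ _ K0 K1) => //.
- move=> f h /ffunP E; apply/asboolP => v _.
  have gen_inv (k : Aut W) : k (g v) * k (g v) = 1.
    by rewrite -gmulfM coxeter_genM gmulf1.
  have := E v; rewrite !ffunE => /(FP _ _ (gen_inv f) (gen_inv h))[x hx].
  by exists (f^-1 x); rewrite autME hx autJ aut_invVK.
- move=> f h fP hP /out_eqP /asboolP[a aE].
  apply/asboolP; split; first by rewrite fix_outer_classesM ?fix_outer_classesV.
  exists (val a) => [|x xO]; first exact: valP.
  pose x' : subgroup WO := Sub x xO.
  have := congr1 (b f) (aE x'); rewrite -autME mulgA mulgV mul1g => /(congr1 val).
  rewrite !bP // => E.
  (* By [E], [h] induces the conjugation by [a] followed by the action of [f]; [rho_aut] lets [f^-1]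
     cancel [f] under [rho]. *)
  rewrite autME -rho_aut ?fix_outer_classesV // -[h x]/(h (val x')) E.
  rewrite rho_aut ?fix_outer_classesV // aut_invVK.
  rewrite rho_id; first by rewrite !gmulfM gmulfV.
  exact: valP.
Qed.

End VirtualSurjection.

Theorem theorem1p7 (Gamma : coxeterGraph) (Omega : {set Gamma})
    (Omega_infinite : infinite_group (subgroup (special Omega)))
    (Out_finite : finite_group (Out (subgroup (special Omega))))
    (even_labels : forall v w : Gamma,
       v \notin Omega -> w \in Omega -> edge v w -> ~~ odd (edge_label v w)) :
  exists (H : groupClosed (Aut (coxeterGroup Gamma))) (Lambda : {set Gamma})
         (phi : {multiplicative subgroup H -> subgroup (special Lambda)}),
    [/\ finite_index H,
        Lambda \subset Omega,
        infinite_group (subgroup (special Lambda)) &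
        forall y, exists x, phi x = y].
Proof.
have [rho [rhoM rho_special rho_id rho_out]] := special_retraction even_labels.
have /infinite_centerless[L [dirL Linf centerless]] :=
  (infinite_subgroup _).1 Omega_infinite.
have LO : L \subset Omega by case: dirL.
have [pi [piM pi_special pi_id _]] :=
  special_retraction (even_boundary_direct_part even_labels dirL).
(* Elements inducing the same conjugation differ by a central element of [W_Omega]. Its image under
   [pi] is central in [W_L], hence trivial, so the value of [phi] does not depend on the choice made
   in [conj_by]. *)
have pi_unique a b : a \in special Omega -> b \in special Omega ->
    (forall x, x \in special Omega -> a * x / a = b * x / b) -> pi a = pi b.
  move=> aO bO E; have z1 : pi (b^-1 * a) = 1.
    apply: centerless => // v vL.
    have vO : coxeter_gen v \in special Omega.
      exact/coxeter_gen_special/(fintype.subsetP LO).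
    rewrite /commute -(pi_id _ (coxeter_gen_special vL)) -!piM; congr (pi _).
    apply: (mulgI b); apply: (mulIg a^-1).
    have := E _ vO; rewrite !mulgA mulgV mul1g => ->.
    by rewrite -[_ / b * a / a]mulgA mulgV mulg1.
  by rewrite -[a](mulVKg b) piM z1 mulg1.
pose H := inner_on_special_group rhoM rho_special rho_id rho_out.
have /choice[conj_by conj_byP] : forall f : subgroup H, exists a,
    a \in special Omega /\
    forall x, x \in special Omega -> rho (val f x) = a * x / a.
  by move=> f; have /asboolP[_ [a aO aE]] := valP f; exists a.
pose phi (f : subgroup H) : subgroup (special L) :=
  Sub (pi (conj_by f)) (pi_special (conj_by f)).
have piE (f : subgroup H) a : a \in special Omega ->
    (forall x, x \in special Omega -> rho (val f x) = a * x / a) ->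
    pi (conj_by f) = pi a.
  move=> aO aE; have [cO cE] := conj_byP f; apply: pi_unique => // x xO.
  by rewrite -cE // aE.
have phiM : {morph phi : f h / f * h}.
  move=> f h; apply: val_inj; rewrite valM /= -piM.
  have [[aO aE] [bO bE]] := (conj_byP f, conj_byP h).
  apply: piE => [|x xO]; first by rewrite gpredM.
  have /asboolP[fP _] := valP f.
  rewrite valM autME -(rho_aut rhoM rho_id rho_out) // bE // aE ?gpredM ?gpredV //.
  by rewrite invgM !mulgA.
pose Phi : {multiplicative subgroup H -> subgroup (special L)} :=
  HB.pack phi (isMultiplicative.Build _ _ phi phiM).
exists H, L, Phi; split=> //.
- exact: finite_index_inner_on_special.
- exact/infinite_subgroup.
(* A preimage of [y] is the inner automorphism of the whole group given by [y], which maps each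
   generator to a conjugate and so lies in [H]. *)
move=> y; have yO : val y \in special Omega by exact: special_sub LO _ (valP y).
pose c (x : coxeterGroup Gamma) := val y * x / val y.
have cM : {morph c : x z / x * z} by move=> x z; rewrite /c !mulgA mulgVK.
have c_bij : bijective c.
  exists (fun x => (val y)^-1 * x * val y) => x; rewrite /c.
    by rewrite !mulgA mulVg mul1g mulgVK.
  by rewrite !mulgA mulgV mul1g mulgK.
pose f := Automorphism cM c_bij.
have fE x : x \in special Omega -> rho (f x) = val y * x / val y.
  by move=> xO; rewrite rho_id // /f /= /c !gpredM ?gpredV.
have fH : f \in H.
  apply/asboolP; split; last by exists (val y).
  by apply/asboolP => v _; exists (val y)^-1; rewrite conjgE invgK mulgA.
exists (Sub f fH : subgroup H); apply: val_inj => /=.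
by rewrite (piE _ (val y)) // pi_id //; exact: valP.
Qed.
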